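(* Let $\mathcal{C}=\mathcal{C}(I,\mathcal{X},r,A)$ be a connected indecomposable finite Cartan graph. Then there exists $X\in\mathcal{X}$ such that the Cartan matrix $A^X$ is of finite type.
   Context: Let $\theta\in\mathbb{N}$, $I=\{1,\dots,\theta\}$, $\mathcal{X}$ a non-empty set, $r=(r_i)_{i\in I}$ a family of maps $r_i:\mathcal{X}\to\mathcal{X}$, and $A=(A^X)_{X\in\mathcal{X}}$ a family of generalized Cartan matrices $A^X=(a_{ij}^X)_{i,j\in I}$. The quadruple $\mathcal{C}(I,\mathcal{X},r,A)$ is a semi-Cartan graph if $r_i^2=\mathrm{id}$ for all $i$ and $a_{ij}^X=a_{ij}^{r_i(X)}$ for all $X\in\mathcal{X}$, $i,j\in I$. It is connected if there is no proper non-empty subset $\mathcal{Y}\subset\mathcal{X}$ with $r_i(\mathcal{Y})\subseteq\mathcal{Y}$ for all $i\in I$. Let $\alpha_1,\dots,\alpha_\theta$ be the standard basis of $\mathbb{Z}^\theta$ and $s_i^X\in\mathrm{Aut}(\mathbb{Z}^\theta)$, $s_i^X\alpha_j=\alpha_j-a_{ij}^X\alpha_i$. $\mathcal{W}(\mathcal{C})$ is the groupoid with object set $\mathcal{X}$ whose morphisms are the triples $(Y,f,X)$ (from $X$ to $Y$, $f\in\mathrm{Aut}(\mathbb{Z}^\theta)$) generated by all $(r_i(X),s_i^X,X)$ under $(Z,g,Y)\circ(Y,f,X)=(Z,gf,X)$. The set of real roots at $X$ is $\mathbf{\Delta}^{\mathrm{re}\,X}=\{f\alpha_i: i\in I,\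 (X,f,Y)\in\mathrm{Hom}(Y,X),\ Y\in\mathcal{X}\}\subseteq\mathbb{Z}^\theta$. The semi-Cartan graph is finite if $\mathbf{\Delta}^{\mathrm{re}\,X}$ is finite for all $X$. It is a Cartan graph if (1) for every $X$ we have $\mathbf{\Delta}^{\mathrm{re}\,X}\subseteq\mathbb{N}_0^I\cup-\mathbb{N}_0^I$, and (2) for all $X\in\mathcal{X}$, $i,j\in I$, if $t_{ij}^X=|\mathbf{\Delta}^{\mathrm{re}\,X}\cap(\mathbb{N}_0\alpha_i+\mathbb{N}_0\alpha_j)|<\infty$ then $(r_ir_j)^{t_{ij}^X}(X)=X$. A connected semi-Cartan graph is indecomposable if there exists $X\in\mathcal{X}$ such that $A^X$ is indecomposable, i.e. there are no disjoint non-empty $I_1,I_2$ with $I_1\cup I_2=I$ and $a_{ij}^X=0$ for all $i\in I_1$, $j\in I_2$. (An indecomposable generalized Cartan matrix is of finite type in the usual sense of Kac's trichotomy finite/affine/indefinite.) *)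

(* Defs.v *)
From HB Require Import structures.
From mathcomp Require Import all_boot all_order all_algebra.
From mathcomp Require Import mathcomp_extra boolp classical_sets functions cardinality reals.
From mathcomp Require Import ring.

Set Implicit Arguments.
Unset Strict Implicit.
Unset Printing Implicit Defensive.

Import Order.TTheory GRing.Theory Num.Theory.
Local Open Scope classical_set_scope.
Local Open Scope ring_scope.

Definition gen_cartan_mx n (A : 'M[int]_n) : Prop :=
  [/\ forall i, A i i = 2,
      forall i j, i != j -> A i j <= 0
    & forall i j, A i j = 0 -> A j i = 0].

Definition indecomposable_mx n (A : 'M[int]_n) : Prop :=
  ~ exists I1 I2 : {set 'I_n},
      [/\ I1 != finset.set0, I2 != finset.set0, I1 :&: I2 = finset.set0,
          I1 :|: I2 = finset.setT
        & forall i j, i \in I1 -> j \in I2 -> A i j = 0].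

(* Condition (Fin) in Theorem 4.3 of Kac, "Infinite dimensional Lie algebras",
   for real column vectors; v > 0 and v >= 0 are meant entrywise.  A generalized
   Cartan matrix of positive size satisfying these clauses is automatically
   indecomposable. *)
Definition finite_type (R : realType) n (A : 'M[int]_n) : Prop :=
  let AR := map_mx intr A : 'M[R]_n in
  [/\ \det AR != 0,
      exists u : 'cV[R]_n,
        (forall i, 0 < u i 0) /\ (forall i, 0 < (AR *m u) i 0)
    & forall v : 'cV[R]_n, (forall i, 0 <= (AR *m v) i 0) ->
        (forall i, 0 < v i 0) \/ v = 0].

Record semi_cartan_graph (theta : nat) := SemiCartanGraph {
  obj :> Type;
  obj_inhabited : inhabited obj;
  refl : 'I_theta -> obj -> obj;
  cartan : obj -> 'M[int]_theta;
  cartan_gen : forall X, gen_cartan_mx (cartan X);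
  reflK : forall i X, refl i (refl i X) = X;
  cartan_refl : forall i j X, cartan X i j = cartan (refl i X) i j
}.

Section SemiCartanGraph.
Variables (theta : nat) (C : semi_cartan_graph theta).

(* Endomorphisms of Z^theta are integer matrices acting on column vectors. *)
Definition alpha (i : 'I_theta) : 'cV[int]_theta := delta_mx i 0.

Definition smx (X : C) (i : 'I_theta) : 'M[int]_theta :=
  \matrix_(k, j) ((k == j)%:R - cartan X i j * (k == i)%:R).

Lemma smx_alpha X i j : smx X i *m alpha j = alpha j - cartan X i j *: alpha i.
Proof.
apply/colP => k; rewrite !mxE (bigD1 j) //= !mxE !eqxx mulr1 big1 ?addr0.
  by rewrite !andbT.
by move=> l lj; rewrite !mxE (negPf lj) mulr0.
Qed.

Lemma smxK X i : smx X i *m smx X i = 1%:M.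
Proof.
have [aii _ _] := cartan_gen X.
apply/matrixP => k j; rewrite !mxE.
under eq_bigr => l _ do rewrite !mxE mulrBl.
rewrite sumrB (bigD1 k) //= eqxx mul1r big1 ?addr0; last first.
  by move=> l lk; rewrite eq_sym (negPf lk) mul0r.
under eq_bigr => l _ do rewrite mulrBr.
rewrite sumrB (bigD1 j) //= eqxx mulr1 big1 ?addr0; last first.
  by move=> l lj; rewrite (negPf lj) mulr0.
rewrite (bigD1 i) //= eqxx mulr1 big1 ?addr0; last first.
  by move=> l li; rewrite (negPf li) !mulr0.
rewrite aii; ring.
Qed.

(* [hom Y f X] says that (Y, f, X) is a morphism from X to Y in the Weyl
   groupoid. *)
Inductive hom : C -> 'M[int]_theta -> C -> Prop :=
| hom_id X : hom X 1%:M X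
| hom_gen X i : hom (refl i X) (smx X i) X
| hom_comp X Y Z g f : hom Z g Y -> hom Y f X -> hom Z (g *m f) X.

Lemma smx_refl X i : smx (refl i X) i = smx X i.
Proof. by apply/matrixP => k j; rewrite !mxE -cartan_refl. Qed.

(* Closure under inverses need not be imposed on [hom]: the generators are
   pairwise inverse. *)
Lemma hom_inv Y f X : hom Y f X -> f \in unitmx /\ hom X (invmx f) Y.
Proof.
elim=> {Y f X} [X|X i|X Y Z g f _ [ug hg] _ [uf hf]].
- by split; [exact: unitmx1 | rewrite invmx1; exact: hom_id].
- have [us _] := mulmx1_unit (smxK X i); split=> //.
  have -> : invmx (smx X i) = smx (refl i X) i.
    by rewrite smx_refl -[LHS]mulmx1 -(smxK X i) mulmxA mulVmx // mul1mx.
  by have := hom_gen (refl i X) i; rewrite reflK.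
- split; first by rewrite unitmx_mul ug uf.
  have -> : invmx (g *m f) = invmx f *m invmx g.
    have ugf : g *m f \in unitmx by rewrite unitmx_mul ug uf.
    apply: (can_inj (mulKmx ugf)).
    by rewrite mulmxV // -mulmxA (mulmxA f) mulmxV // mul1mx mulmxV.
  exact: hom_comp hf hg.
Qed.

Definition real_roots (X : C) : set 'cV[int]_theta :=
  [set v | exists (Y : C) (f : 'M[int]_theta) (i : 'I_theta),
     hom X f Y /\ v = f *m alpha i].

Definition graph_connected : Prop :=
  ~ exists Y : set C,
      [/\ Y `<` setT, Y !=set0 & forall i, refl i @` Y `<=` Y].

Definition graph_finite : Prop := forall X, finite_set (real_roots X).

Definition cone2 (i j : 'I_theta) : set 'cV[int]_theta :=
  [set v | exists m n : nat, v = alpha i *+ m + alpha j *+ n].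

Definition cartan_graph : Prop :=
  (forall X v, real_roots X v ->
     (forall k, 0 <= v k 0) \/ (forall k, v k 0 <= 0)) /\
  (forall X i j (t : nat), (real_roots X `&` cone2 i j #= `I_t)%card ->
     iter t (refl i \o refl j) X = X).

Definition graph_indecomposable : Prop :=
  exists X : C, indecomposable_mx (cartan X).

End SemiCartanGraph.

(* Main.v *)
Require Import Defs.
From HB Require Import structures.
From mathcomp Require Import all_boot all_order all_algebra.
From mathcomp Require Import mathcomp_extra boolp classical_sets functions cardinality reals.
From mathcomp Require Import zify.

(** Fix an object [X0] with roots [rs], and for a morphism [f : X0 -> X] let
    [u] be the sum of the entrywise absolute values [|f v|], [v] in [rs]; this
    is the sum of all positive roots at [X], counted twice.  The reflection
    [s_i] only changes the signs of the roots [+-alpha_i], so that [(A^X u)_i]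
    exceeds the difference of the heights of [u] for [f] and for [s_i f].  As
    [f^-1] maps simple roots to elements of [rs], there are only finitely many
    [f], and one of maximal height satisfies [A^X u > 0] with [u > 0].  By Kac's
    criterion [A^X] is of finite type once it is indecomposable, and
    decomposability propagates along reflections: otherwise
    [s_j s_i s_j alpha_k] would be a root with coefficients of both signs. *)

Set Implicit Arguments.
Unset Strict Implicit.
Unset Printing Implicit Defensive.

Import Order.TTheory GRing.Theory Num.Theory Defs.
Local Open Scope classical_set_scope.
Local Open Scope ring_scope.

(** * Kac's criterion: a positive vector with positive image *)

Section FiniteTypeCriterion.
Variables (R : realType) (n : nat) (A : 'M[int]_n) (u : 'cV[R]_n).
Let AR : 'M[R]_n := map_mx intr A.
Hypotheses (Agen : gen_cartan_mx A)
  (u_gt0 : forall i, 0 < u i 0) (Au_gt0 : forall i, 0 < (AR *m u) i 0).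

Lemma mulmx_zero_le0 (w : 'cV[R]_n) i : (forall j, 0 <= w j 0) -> w i 0 = 0 ->
  forall j, (AR *m w) i 0 <= AR i j * w j 0.
Proof.
have [_ Ale0 _] := Agen.
move=> w_ge0 wi0 j; rewrite mxE (bigD1 j) //= gerDl sumr_le0 // => k _.
have [->|ki] := eqVneq k i; first by rewrite wi0 mulr0.
by rewrite mulr_le0_ge0 // mxE lerz0 Ale0 // eq_sym.
Qed.

(** If [v] had a negative entry, the minimum [c] of the ratios [v i / u i] would be negative. Then
    [v - c u] is nonnegative and vanishes at a minimizing index, where its image is at most 0; but
    that image is positive there, since [- c (A u) > 0]. *)
Lemma mulmx_ge0_ge0 (v : 'cV[R]_n) :
  (forall i, 0 <= (AR *m v) i 0) -> forall i, 0 <= v i 0.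
Proof.
move=> Av_ge0 i1; rewrite leNgt; apply/negP => vi1.
case: (@arg_minP _ R _ i1 xpredT (fun i => v i 0 / u i 0)) => // i0 _ i0min.
set c := v i0 0 / u i0 0 in i0min.
have c_lt0 : c < 0.
  apply: le_lt_trans (i0min i1 isT) _.
  by rewrite ltr_pdivrMr // mul0r.
pose w := v - c *: u.
have w_ge0 j : 0 <= w j 0.
  by rewrite !mxE subr_ge0 -ler_pdivlMr // i0min.
have wi0 : w i0 0 = 0 by rewrite !mxE /c mulfVK ?subrr // gt_eqF.
have := mulmx_zero_le0 w_ge0 wi0 i0; rewrite wi0 mulr0 leNgt => /negP; apply.
rewrite mulmxBr -scalemxAr !mxE -/(AR) subr_gt0.
have := Av_ge0 i0; have := Au_gt0 i0; rewrite !mxE => Aui0 Avi0.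
by apply: lt_le_trans Avi0; rewrite nmulr_rlt0.
Qed.

Lemma finite_type_of_pos : indecomposable_mx A -> finite_type R A.
Proof.
move=> Aind; split.
- apply/negP; rewrite -det_tr => /det0P [v v0 vA].
  have Av : AR *m v^T = 0 by rewrite -[AR]trmxK -trmx_mul vA trmx0.
  case/negP: v0; apply/eqP/rowP => i; apply/eqP; rewrite mxE eq_le.
  (* A kernel vector and its negative both have nonnegative image, so both are nonnegative. *)
  have := @mulmx_ge0_ge0 v^T; rewrite Av => vge0.
  have := @mulmx_ge0_ge0 (- v^T); rewrite mulmxN Av oppr0 => vle0.
  have := vge0 _ i; have := vle0 _ i; rewrite !mxE oppr_ge0 => -> => [->//|];
    by move=> j; rewrite mxE.
- by exists u.
- move=> v Av_ge0; have v_ge0 := mulmx_ge0_ge0 Av_ge0.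
  (* The zero set of [v] and its complement split [A] into blocks, so one of them is empty. *)
  pose Z := [set i | v i 0 == 0]%SET.
  have AZ i j : i \in Z -> j \in ~: Z -> A i j = 0.
    rewrite !inE => /eqP vi0 vj0; apply/eqP; rewrite -[_ == 0](@intr_eq0 R).
    have := mulmx_zero_le0 v_ge0 vi0 j => /(le_trans (Av_ge0 i)).
    have vj_gt0 : 0 < v j 0 by rewrite lt_def vj0 v_ge0.
    rewrite mxE pmulr_lge0 // => Aij_ge0.
    rewrite eq_le Aij_ge0 andbT lerz0; have [_ -> //] := Agen.
    by apply: contraNneq vj0 => <-; rewrite vi0.
  have [Z0|Zn0] := eqVneq Z finset.set0.
    left=> i; rewrite lt_def v_ge0 andbT; apply/negP => vi0.
    by have := finset.in_set0 i; rewrite -Z0 inE vi0.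
  have [ZC0|ZCn0] := eqVneq (~: Z)%SET finset.set0.
    right; apply/colP => i; rewrite mxE; apply/eqP.
    by have := finset.in_set0 i; rewrite -ZC0 !inE => /negbFE.
  case: Aind; exists Z, (~: Z)%SET; split=> //.
    by rewrite finset.setICr.
  by rewrite finset.setUCr.
Qed.

End FiniteTypeCriterion.

(** * Real roots under simple reflections *)

Section CartanGraph.
Variables (theta : nat) (C : semi_cartan_graph theta).
Implicit Types (X Y : C) (i j k : 'I_theta).

Lemma smxE X i (w : 'cV[int]_theta) k :
  (smx X i *m w) k 0 = w k 0 - (cartan X *m w) i 0 *+ (k == i).
Proof.
rewrite !mxE (eq_bigr (fun j => (k == j)%:R * w j 0 -
  (cartan X i j * w j 0) *+ (k == i))); last first.
  by move=> j _; rewrite mxE mulrBl (mulr_natr (cartan X i j)) -mulrnAl.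
rewrite sumrB sumrMnl (bigD1 k) //= eqxx mul1r big1 ?addr0 // => j jk.
by rewrite eq_sym (negPf jk) mul0r.
Qed.

Lemma real_roots_hom Y f X v :
  hom Y f X -> real_roots X v -> real_roots Y (f *m v).
Proof.
move=> hf [Z [g [i [hg ->]]]]; exists Z, (f *m g), i.
by rewrite mulmxA; split=> //; exact: hom_comp hg.
Qed.

Lemma real_roots_alpha X i : real_roots X (alpha i).
Proof. by exists X, 1%:M, i; rewrite mul1mx; split=> //; exact: hom_id. Qed.

Lemma real_roots_smx X i v :
  real_roots X v -> real_roots (refl i X) (smx X i *m v).
Proof. by apply: real_roots_hom; exact: hom_gen. Qed.

Hypothesis rootP : forall X v, real_roots X v ->
  (forall k, 0 <= v k 0) \/ (forall k, v k 0 <= 0).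

Definition abs_col (v : 'cV[int]_theta) : 'cV[int]_theta := map_mx Num.norm v.

(** On a multiple of [alpha i] the left side is 0. Otherwise [v] has a nonzero coefficient away from
    [i], which the reflection preserves; hence [v] and its image have the same sign, and equality
    holds. *)
Lemma cartan_abs_root X i v : real_roots X v ->
  `|v i 0| - `|(smx X i *m v) i 0| <= (cartan X *m abs_col v) i 0.
Proof.
move=> rv; have rsv := real_roots_smx i rv.
have [aii _ _] := cartan_gen X.
have [/forallP v0|/forallPn [k]] := boolP [forall k, (k != i) ==> (v k 0 == 0)].
  have E (w : 'cV[int]_theta) : (forall k, k != i -> w k 0 = 0) ->
      (cartan X *m w) i 0 = 2 * w i 0.
    move=> w0; rewrite mxE (bigD1 i) //= aii big1 ?addr0 // => k ki.
    by rewrite w0 ?mulr0.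
  rewrite smxE eqxx mulr1n !E; first last.
  - by move=> k ki; apply/eqP; exact: (implyP (v0 k)).
  - by move=> k ki; rewrite mxE (eqP (implyP (v0 k) ki)) normr0.
  rewrite mxE; lia.
rewrite negb_imply => /andP [ki vk0].
have svk : (smx X i *m v) k 0 = v k 0 by rewrite smxE (negPf ki) subr0.
case: (rootP rv) => vs; case: (rootP rsv) => svs.
- have -> : abs_col v = v by apply/colP => j; rewrite mxE ger0_norm.
  by rewrite !ger0_norm // smxE eqxx opprB addrC subrK.
- by case/eqP: vk0; have := svs k; have := vs k; rewrite svk; lia.
- by case/eqP: vk0; have := svs k; have := vs k; rewrite svk; lia.
- have -> : abs_col v = - v by apply/colP => j; rewrite !mxE ler0_norm.
  by rewrite !ler0_norm // smxE eqxx mulr1n opprK addKr mulmxN [leRHS]mxE.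
Qed.

(** The source of strict positivity in [root_pos_vector]: the inequality reads [0 < 2]. *)
Lemma cartan_abs_alpha X i :
  `|(alpha i : 'cV[int]_theta) i 0| - `|(smx X i *m alpha i) i 0|
    < (cartan X *m abs_col (alpha i)) i 0.
Proof.
have [aii _ _] := cartan_gen X.
rewrite smx_alpha aii [ltRHS]mxE (bigD1 i) //= big1 ?addr0 => [|k ki].
  by rewrite !mxE !eqxx aii.
by rewrite !mxE (negPf ki) normr0 mulr0.
Qed.

Lemma root_pos_vector X0 : graph_finite C ->
  exists X, exists u : 'cV[int]_theta,
    (forall i, 0 < u i 0) /\ (forall i, 0 < (cartan X *m u) i 0).
Proof.
move=> fin.
have /finite_seqP [rs rsE] := fin X0.
have rsP v : v \in rs <-> real_roots X0 v by rewrite rsE.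
pose T := {ffun 'I_theta -> 'I_(size rs)}.
(* [h] selects the columns of the inverse from [rs]. Choices giving a singular matrix are ruled out
   by [P] below, as morphisms are invertible. *)
pose mx (h : T) : 'M[int]_theta :=
  invmx (\matrix_(k, j) (nth 0 rs (h j)) k 0).
have homE X f : hom X f X0 -> exists h, f = mx h.
  move=> hf; have [uf hV] := hom_inv hf.
  have ltj j : (index (invmx f *m alpha j) rs < size rs)%N.
    rewrite index_mem; apply/rsP/(real_roots_hom hV)/real_roots_alpha.
  exists [ffun j => Ordinal (ltj j)]; rewrite -[LHS]invmxK /mx; congr invmx.
  apply/matrixP => k j; rewrite mxE ffunE /= nth_index -?index_mem //.
  by rewrite -colE mxE.
pose B (f : 'M[int]_theta) := \sum_(v <- rs) abs_col (f *m v).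
pose ht (f : 'M[int]_theta) : int := \sum_i B f i 0.
pose P (h : T) := `[< exists X, hom X (mx h) X0 >].
have [h0 h0E] := homE _ _ (hom_id X0).
have Ph0 : P h0 by apply/asboolP; exists X0; rewrite -h0E; exact: hom_id.
case: (@arg_maxP _ int _ h0 P (ht \o mx) Ph0) => h.
move=> /asboolP [X hX] /= hmax.
set f := mx h in hX hmax.
have BE (g : 'M[int]_theta) i : B g i 0 = \sum_(v <- rs) `|(g *m v) i 0|.
  by rewrite summxE; apply: eq_bigr => v _; rewrite mxE.
have [uf hV] := hom_inv hX.
have alphaP i : exists2 v, v \in rs & f *m v = alpha i.
  exists (invmx f *m alpha i); last by rewrite mulKVmx.
  by apply/rsP/(real_roots_hom hV)/real_roots_alpha.
exists X, (B f); split=> i.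
  have [v vrs fv] := alphaP i.
  by rewrite BE (big_rem v) //= fv mxE !eqxx ltr_pwDl // sumr_ge0.
(* The reflection changes only coordinate [i], so maximality of the height bounds that coordinate
   alone. *)
have ht_le : 0 <= B f i 0 - B (smx X i *m f) i 0.
  have [h' h'E] := homE _ _ (hom_comp (hom_gen X i) hX).
  have Ph' : P h'.
    by apply/asboolP; exists (refl i X); rewrite -h'E; exact: hom_comp (hom_gen X i) hX.
  have := hmax h' Ph'; rewrite -h'E.
  rewrite /ht (bigD1 i) //= [leRHS](bigD1 i) //= subr_ge0.
  rewrite [X in _ + X <= _](eq_bigr (fun j => B f j 0)) ?lerD2r // => j ji.
  rewrite !BE; apply: eq_bigr => v _.
  by rewrite -mulmxA smxE (negPf ji) subr0.
apply: le_lt_trans ht_le _.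
rewrite /B mulmx_sumr !summxE -sumrB.
have [v vrs fv] := alphaP i.
rewrite (big_rem v) //= [ltRHS](big_rem v) //=.
apply: ltr_leD.
  by rewrite ![abs_col _ i 0]mxE -mulmxA fv cartan_abs_alpha.
rewrite big_seq [leRHS]big_seq; apply: ler_sum => w /mem_rem wrs.
rewrite ![abs_col _ i 0]mxE -mulmxA; apply: cartan_abs_root.
exact/(real_roots_hom hX)/rsP.
Qed.

(** Row [i] is unchanged by [refl i]. For another [k] in [I1], the root [v] has coefficient 1 at
    [alpha k] and [a <= 0] at [alpha j], so [a = 0]. *)
Lemma decomp_refl X i (I1 I2 : {set 'I_theta}) :
  I1 :&: I2 = finset.set0 -> i \in I1 ->
  (forall k j, k \in I1 -> j \in I2 -> cartan X k j = 0) ->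
  forall k j, k \in I1 -> j \in I2 -> cartan (refl i X) k j = 0.
Proof.
move=> dis iI1 dec k j kI1 jI2.
have neq a b : a \in I1 -> b \in I2 -> a != b.
  move=> aI1 bI2; apply/eqP => ab; have := finset.in_set0 a.
  by rewrite -dis inE aI1 ab bI2.
have [->|ki] := eqVneq k i; first by rewrite -cartan_refl dec.
have [_ Ale0 Asym] := cartan_gen (refl i X).
have [ajj _ AXsym] := cartan_gen X.
apply: Asym; set a := cartan _ j k.
have a_le0 : a <= 0 by rewrite Ale0 // eq_sym neq.
(* [alpha k] is carried from [refl j (refl i X)] through [refl i X] and [X] to [refl j X]. Only the
   first reflection sees [a]; the other two use the zero blocks at [X]. *)
pose v := smx X j *m (smx (refl i X) i *m
  (smx (refl j (refl i X)) j *m alpha k)).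
have rv : real_roots (refl j X) v.
  apply: real_roots_smx; rewrite -[X in real_roots X](reflK i).
  apply: real_roots_smx; rewrite -[X in real_roots X](reflK j).
  exact/real_roots_smx/real_roots_alpha.
have vE : v = alpha k - cartan X i k *: alpha i + a *: alpha j.
  have Xjk : cartan X j k = 0 by apply: AXsym; exact: dec.
  have Xji : cartan X j i = 0 by apply: AXsym; exact: dec.
  rewrite /v (smx_refl (refl i X) j) smx_alpha -/a mulmxBr -scalemxAr.
  rewrite smx_refl !smx_alpha.
  rewrite (dec i j) // scale0r subr0 !mulmxBr -!scalemxAr !smx_alpha.
  rewrite Xjk Xji ajj !scale0r !subr0; congr (_ + _).
  by rewrite -scalerN opprB scaler_nat mulr2n addrK.
have vk : v k 0 = 1.
  by rewrite vE !mxE eqxx (negPf ki) (negPf (neq _ _ kI1 jI2)) !mulr0 subr0 addr0.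
have vj : v j 0 = a.
  rewrite vE !mxE !eqxx ![j == _]eq_sym (negPf (neq _ _ kI1 jI2)).
  by rewrite (negPf (neq _ _ iI1 jI2)) mulr0 mulr1 subr0 add0r.
have [/(_ j)|/(_ k)] := rootP rv; last by rewrite vk.
by rewrite vj => a_ge0; apply/eqP; rewrite eq_le a_le0.
Qed.

Lemma indecomposable_everywhere :
  graph_connected C -> graph_indecomposable C ->
  forall X, indecomposable_mx (cartan X).
Proof.
move=> conn [X0 ind0] X [I1 [I2 [I1n0 I2n0 dis cov dec]]].
(* [D] is stable under reflections, contains [X] and misses [X0], against connectedness. *)
pose D : set C := [set Y | forall k j,
  k \in I1 -> j \in I2 -> cartan Y k j = 0].
have Dsym Y k j : D Y -> k \in I2 -> j \in I1 -> cartan Y k j = 0.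
  by have [_ _ s] := cartan_gen Y => DY kI2 jI1; apply: s; exact: DY.
apply: conn; exists D; split.
- rewrite properEneq; split=> //; apply/eqP => DT; apply: ind0.
  by exists I1, I2; split=> //; have : D X0 by rewrite DT.
- by exists X.
- move=> i _ [Y DY <-].
  have : i \in I1 :|: I2 by rewrite cov inE.
  rewrite inE => /orP [iI1|iI2]; first exact: decomp_refl.
  have [_ _ s] := cartan_gen (refl i Y).
  move=> k j kI1 jI2; apply: s.
  apply: (@decomp_refl Y i I2 I1) => //; first by rewrite finset.setIC.
  by move=> *; exact: Dsym.
Qed.

End CartanGraph.

Theorem theorem4p2 (R : realType) (theta : nat) (theta_gt0 : (0 < theta)%N)
    (C : semi_cartan_graph theta) :
  cartan_graph C -> graph_finite C ->
  graph_connected C -> graph_indecomposable C ->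
  exists X : C, finite_type R (cartan X).
Proof.
move=> [rootP _] fin conn ind; have [X0] := obj_inhabited C.
have [X [u [u_gt0 Au_gt0]]] := root_pos_vector rootP X0 fin.
exists X; apply: (@finite_type_of_pos _ _ _ (map_mx intr u)).
- exact: cartan_gen.
- by move=> i; rewrite mxE ltr0z.
- by move=> i; rewrite -map_mxM mxE ltr0z.
- exact: (indecomposable_everywhere rootP conn ind).
Qed.
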